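(* Let $p$ be a prime number and let $a$ and $n$ be positive integers with $n>a$ and $n\not\equiv 0 \pmod{p-1}$. Then $$\sum_{r=0}^{a}\binom{a}{r}(-1)^r\, c_{p-1}^{\,a-r}\,\frac{\hat{B}_{n+r(p-1)}}{n+r(p-1)}\equiv 0 \pmod{p^{\lfloor a/2\rfloor}},$$ i.e. every coefficient of this polynomial in $\mathbf{Q}[c_1,c_2,\dots]$ is a rational number whose $p$-adic valuation is at least $\lfloor a/2\rfloor$.
   Context: Let $c_1,c_2,\dots$ be indeterminates and consider the power series $u(t)=t+\sum_{n\ge 1}c_n\frac{t^{n+1}}{n+1}$ and its compositional inverse $t(u)=u-c_1\frac{u^2}{2!}+\cdots$. The universal Bernoulli numbers $\hat{B}_n\in\mathbf{Q}[c_1,c_2,\dots]$ are defined by $\frac{u}{t(u)}=\sum_{n\ge0}\hat{B}_n\frac{u^n}{n!}$. A congruence between polynomials in $c_1,c_2,\dots$ with rational coefficients modulo $p^k$ means the congruence holds coefficientwise, i.e. each coefficient of the difference has $p$-adic valuation $\ge k$. $\lfloor x\rfloor$ denotes the greatest integer not exceeding $x$. *)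

(* Defs.v *)
From mathcomp Require Import all_boot all_order all_algebra.
From mathcomp Require Import zify monalg.

Set Implicit Arguments.
Unset Strict Implicit.
Unset Printing Implicit Defensive.

Import GRing.Theory.
Local Open Scope ring_scope.

(* Formal power series over [A], as coefficient sequences. *)
Section Series.
Variable A : comNzRingType.
Implicit Types f g : nat -> A.

Definition ser0 : nat -> A := fun _ => 0.
Definition ser1 : nat -> A := fun n => (n == 0)%:R.
Definition serX : nat -> A := fun n => (n == 1)%:R.
Definition sermul f g : nat -> A := fun n => \sum_(i < n.+1) f i * g (n - i)%N.
Definition serexp f k : nat -> A := iter k (sermul f) ser1.
Arguments serexp : simpl never.

(* Composition [f(g)], meaningful when [g 0 = 0]: [g ^ k] then has order at
   least [k], so that only the terms [k <= n] contribute in degree [n]. *)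
Definition sercomp f g : nat -> A := fun n => \sum_(k < n.+1) f k * serexp g k n.

(* The fixed point of an operator whose [n]-th output coefficient only depends
   on the input coefficients of index [< n]. *)
Definition serfix (F : (nat -> A) -> nat -> A) : nat -> A :=
  fun n => iter n.+1 F ser0 n.

(* Multiplicative inverse of a series with constant term [1]. *)
Definition serinv f : nat -> A :=
  serfix (fun g n => ser1 n - \sum_(i < n) f (n - i)%N * g i).

(* Compositional inverse of a series [f] with [f 0 = 0] and [f 1 = 1]. *)
Definition sercompinv f : nat -> A :=
  serfix (fun g n => serX n - \sum_(2 <= k < n.+1) f k * serexp g k n).

Lemma iter_serfix (F : (nat -> A) -> nat -> A) (P : (nat -> A) -> Prop) :
    P ser0 -> (forall f, P f -> P (F f)) ->
    (forall f g n, P f -> P g -> (forall i, (i < n)%N -> f i = g i) ->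
       F f n = F g n) ->
  forall n m, (n < m)%N -> iter m F ser0 n = serfix F n.
Proof.
move=> P0 PF Fc.
have Pit m : P (iter m F ser0) by elim: m => //= m; apply: PF.
have H n : forall m1 m2, (n < m1)%N -> (n < m2)%N ->
    iter m1 F ser0 n = iter m2 F ser0 n.
  elim/ltn_ind: n => n IH [|m1] [|m2] //= lt1 lt2.
  by apply: Fc => // i lti; apply: IH => //; apply: leq_trans lti _.
by move=> n m ltnm; apply: H.
Qed.

Lemma serfixE (F : (nat -> A) -> nat -> A) (P : (nat -> A) -> Prop) :
    P ser0 -> (forall f, P f -> P (F f)) -> P (serfix F) ->
    (forall f g n, P f -> P g -> (forall i, (i < n)%N -> f i = g i) ->
       F f n = F g n) ->
  serfix F =1 F (serfix F).
Proof.
move=> P0 PF Pfix Fc n; rewrite {1}/serfix /=; apply: (Fc) => //.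
  by elim: (n) => //= k; apply: PF.
by move=> i lti; apply: (iter_serfix P0 PF Fc).
Qed.

Lemma sermul_serinv f : f 0%N = 1 -> sermul f (serinv f) =1 ser1.
Proof.
move=> f0 n; have invE : serinv f n =
    ser1 n - \sum_(i < n) f (n - i)%N * serinv f i.
  apply: (@serfixE _ (fun=> True)) => // g h m _ _ eqgh.
  by congr (_ - _); apply: eq_bigr => i _; rewrite eqgh.
rewrite /sermul (reindex_inj rev_ord_inj) /= big_ord_recr /= subSS subnn f0.
rewrite mul1r subn0 invE; apply/eqP; rewrite addrCA -subr_eq0 addrAC subrr.
rewrite add0r subr_eq0; apply/eqP/eq_bigr => i _.
by rewrite !subSS subKn // ltnW.
Qed.

Lemma serexpS g k n :
  serexp g k.+1 n = \sum_(i < n.+1) g i * serexp g k (n - i)%N.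
Proof. by []. Qed.

Lemma serexp_order g k n : g 0%N = 0 -> (n < k)%N -> serexp g k n = 0.
Proof.
move=> g0; elim: k n => // k IH n ltnk; rewrite serexpS.
rewrite big_ord_recl g0 mul0r add0r big1 // => i _; rewrite IH ?mulr0 //.
by rewrite /= /bump /= add1n; have := ltn_ord i; lia.
Qed.

Lemma eq_serexp f g k n :
  (forall i, (i <= n)%N -> f i = g i) -> serexp f k n = serexp g k n.
Proof.
elim: k n => // k IH n eqfg; rewrite !serexpS; apply: eq_bigr => i _.
rewrite eqfg -1?ltnS //; congr (_ * _); apply: IH => j lej.
by apply: eqfg; apply: leq_trans lej (leq_subr _ _).
Qed.

Lemma sercompinv0 f : sercompinv f 0%N = 0.
Proof. by rewrite /sercompinv /serfix /= big_geq // subr0. Qed.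

Lemma sercompinvE f n : sercompinv f n =
  serX n - \sum_(2 <= k < n.+1) f k * serexp (sercompinv f) k n.
Proof.
apply: (@serfixE _ (fun g => g 0%N = 0)) => //.
- by move=> g _; rewrite big_geq // subr0.
- exact: sercompinv0.
move=> {n} g h n g0 h0 eqgh; congr (_ - _); apply: eq_big_nat => -[|[|k]] // _.
congr (_ * _); rewrite (serexpS g) (serexpS h).
apply: eq_bigr => -[[|i] /= lti] _; first by rewrite g0 h0 !mul0r.
have [eqin|neq] := eqVneq i.+1 n.
  by rewrite eqin subnn !serexp_order ?mulr0.
have ltin : (i.+1 < n)%N by rewrite ltn_neqAle neq.
rewrite eqgh //; congr (_ * _); apply: (@eq_serexp g h k.+1) => j lej.
by apply: eqgh; apply: leq_ltn_trans lej _; lia.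
Qed.

Lemma sercomp_sercompinv f :
  f 0%N = 0 -> f 1%N = 1 -> sercomp f (sercompinv f) =1 serX.
Proof.
move=> f0 f1 [|n]; first by rewrite /sercomp big_ord1 f0 mul0r.
rewrite /sercomp -(big_mkord xpredT (fun k => f k * serexp (sercompinv f) k n.+1)).
rewrite big_ltn // f0 mul0r add0r big_ltn // f1 mul1r.
have -> : serexp (sercompinv f) 1 n.+1 = sercompinv f n.+1.
  rewrite serexpS big_ord_recr /= subnn mulr1 big1 ?add0r // => i _.
  by rewrite /serexp /= /ser1 subn_eq0 leqNgt ltn_ord mulr0.
by rewrite {1}sercompinvE subrK.
Qed.

End Series.

Arguments ser0 {A}.
Arguments ser1 {A}.
Arguments serX {A}.

(* The polynomial ring Q[c_1, c_2, ...]; its indeterminates are indexed by all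
   of [nat], the one of index [i] being c_(i+1). *)
Notation Qc := {malg rat[{cmonom nat}]}.

(* [c n] is c_n for [n >= 1]; [c 0] is a junk value. *)
Definition c (n : nat) : Qc := << ucm n.-1 >>.

(* u(t) = t + \sum_(n >= 1) c_n t^(n+1) / (n+1) *)
Definition useries (k : nat) : Qc :=
  match k with
  | 0 => 0
  | 1 => 1
  | n.+1 => (n.+1%:R : rat)^-1 *: c n
  end.

Definition tseries : nat -> Qc := sercompinv useries.

(* The universal Bernoulli number \hat B_n: u / t(u) is the inverse of the
   series t(u) / u, whose [n]-th coefficient is [tseries n.+1]. *)
Definition hatB (n : nat) : Qc :=
  (n`!%:R : rat) *: serinv (fun k => tseries k.+1) n.

Lemma tseries0 : tseries 0%N = 0.
Proof. exact: sercompinv0. Qed.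

Lemma tseries1 : tseries 1%N = 1.
Proof. by rewrite /tseries sercompinvE big_geq // subr0. Qed.

Lemma useries_tseries : sercomp useries tseries =1 serX.
Proof. exact: sercomp_sercompinv. Qed.

Lemma hatB_spec : sermul tseries (fun n => (n`!%:R : rat)^-1 *: hatB n) =1 serX.
Proof.
have invE n : (n`!%:R : rat)^-1 *: hatB n = serinv (fun k => tseries k.+1) n.
  rewrite /hatB scalerA mulVf ?scale1r //.
  by rewrite Num.Theory.pnatr_eq0 -lt0n fact_gt0.
case=> [|n]; rewrite /sermul big_ord_recl tseries0 mul0r add0r ?big_ord0 //.
rewrite -[RHS](sermul_serinv (f := fun k => tseries k.+1) tseries1 n).
by apply: eq_bigr => i _; rewrite invE /= /bump /= add1n subSS.
Qed.

(* p-adic valuation of a nonzero rational number. *)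
Definition padic_val (p : nat) (q : rat) : int :=
  (logn p `|numq q|%N)%:Z - (logn p `|denq q|%N)%:Z.

Definition padic_val_ge (p k : nat) (q : rat) : Prop :=
  q <> 0 -> k%:Z <= padic_val p q.

(* P = Q mod p^k, coefficientwise. *)
Definition Qc_congr (p k : nat) (P Q : Qc) : Prop :=
  forall m : {cmonom nat}, padic_val_ge p k (P - Q)@_m.

(* Main.v *)
Require Import Defs.
From mathcomp Require Import all_boot all_order all_algebra.
From mathcomp Require Import finmap zify ring.
From mathcomp Require Import monalg.

(* Lagrange inversion gives, for [n > 1], an explicit formula

     hatB_n / n = \sum_U (-1)^(d-1) (n + d - 2)! / (\prod_i (i+1)^U_i U_i!) c^U

   over the multi-exponents [U] of weight [\sum_i i U_i = n], where
   [d = \sum_i U_i]. In the coefficient of a monomial [V] in the alternating sum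
   only the exponent of [c_(p-1)] varies, by [s = a - r], and all terms carry the
   same sign apart from that of the factorials [(pq + b - sp)!]. Splitting off the
   powers of [p] from these, and writing [v = V_(p-1)] and [mu = q - v], the
   coefficient becomes, up to sign,

     p^mu mu! / gamma * \sum_s (-1)^s 'C(a, s) 'C(q - s, mu) H(q - s),

   where [H(k)] is [(-1)^k] times the product of the [j <= pk + b] prime to [p],
   and [gamma] is the denominator of the part of [V] away from [c_(p-1)]. The sum
   is an [a]-th finite difference. Those of order [i] of [H] are divisible by
   [p^(ceil(i/2))], since [H(k+1)/H(k)] is [1] mod [p] by Wilson's theorem and is
   a polynomial in [pk]; those of ['C(k, mu)] vanish beyond order [mu]; so the sum
   is divisible by [p^(floor(a/2) - floor(mu/2))]. Finally, the valuation of
   [gamma] is at most [ceil(mu/2) + v(mu!)]; this could fail only for [p = 3] and a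
   power of [c_8], which [n <> 0 mod p - 1] excludes. *)

Set Implicit Arguments.
Unset Strict Implicit.
Unset Printing Implicit Defensive.

Import GRing.Theory.
Local Open Scope ring_scope.

(** * Finite differences of factorials *)

Definition diff (n : nat) (f : nat -> int) : nat -> int :=
  iter n (fun g k => g k.+1 - g k) f.

Lemma diffS n f k : diff n.+1 f k = diff n f k.+1 - diff n f k.
Proof. by []. Qed.

Lemma eq_diff n f g : f =1 g -> diff n f =1 diff n g.
Proof. by move=> fg; elim: n => [|n IH] k //; rewrite !diffS !IH. Qed.

Lemma diffSr n f k : diff n.+1 f k = diff n (fun l => f l.+1 - f l) k.
Proof. by rewrite /diff iterSr. Qed.

Lemma diffD n f g k : diff n (fun l => f l + g l) k = diff n f k + diff n g k.
Proof. by elim: n k => [|n IH] k //; rewrite !diffS !IH; ring. Qed.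

Lemma diffN n f k : diff n (fun l => - f l) k = - diff n f k.
Proof. by elim: n k => [|n IH] k //; rewrite !diffS !IH; ring. Qed.

Lemma diff_shift n f k : diff n (fun l => f l.+1) k = diff n f k.+1.
Proof. by elim: n k => [|n IH] k //; rewrite !diffS !IH. Qed.

Lemma diff_const n (x : int) k : diff n.+1 (fun=> x) k = 0.
Proof.
rewrite diffSr (eq_diff _ (g := fun=> 0)) => [|l]; last by rewrite subrr.
by elim: n k => [|n IH] k //; rewrite diffS !IH subrr.
Qed.

(** Indexed from the top argument downwards, so that [s] can later be the amount by which the
    exponent of c_(p-1) is lowered. *)
Lemma diff_sum n f k :
  diff n f k = \sum_(s < n.+1) (-1) ^+ s * 'C(n, s)%:Z * f (k + (n - s))%N.
Proof.
elim: n k => [|n IH] k; first by rewrite big_ord1 /= bin0 addn0; ring.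
rewrite diffS !IH big_ord_recl [in RHS]big_ord_recl /=.
rewrite -addrA; congr (_ + _); first by rewrite !bin0 !subn0 addSnnS.
rewrite [in RHS]big_ord_recr /= [X in _ - X]big_ord_recr /= /bump leq0n add1n.
rewrite !binn !subnn opprD addrA; congr (_ + _); last by rewrite exprS; ring.
rewrite -sumrB; apply: eq_bigr => i _; rewrite /bump /= !add1n subSS.
have -> : (k.+1 + (n - i.+1) = k + (n - i))%N by have := ltn_ord i; lia.
by rewrite binS PoszD exprS; ring.
Qed.

Lemma diff_bin n m k :
  diff n (fun l => 'C(l, m)%:Z) k = if (n <= m)%N then 'C(k, m - n)%:Z else 0.
Proof.
elim: n k => [|n IH] k; first by rewrite subn0.
rewrite diffS !IH; case: ltngtP => [ltnm|ltmn|->].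
- by rewrite (_ : m - n = (m - n.+1).+1)%N ?binS ?PoszD; [ring | lia].
- by rewrite subrr.
by rewrite subnn !bin0 subrr.
Qed.

(* The discrete Leibniz formula, of which only the divisibility is needed. *)
Lemma dvdz_diffM (d : int) n f g :
  (forall i j k l, (i + j)%N = n -> (d %| diff i f k * diff j g l)%Z) ->
  forall k, (d %| diff n (fun l => f l * g l) k)%Z.
Proof.
elim: n f g => [|n IH] f g dfg k; first exact: (dfg 0%N 0%N k k erefl).
rewrite diffSr (eq_diff _ (g := fun l =>
  (f l.+1 - f l) * g l.+1 + f l * (g l.+1 - g l))) => [|l]; last by ring.
rewrite diffD rpredD //.
  apply: IH => i j k' l' ij; rewrite -diffSr (diff_shift _ g).
  by apply: dfg; rewrite addSn ij.
by apply: IH => i j k' l' ij; rewrite -diffSr; apply: dfg; rewrite addnS ij.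
Qed.

(** * Products of integers prime to [p] *)

Section UnitFactorial.
Variable p : nat.
Hypothesis p_prime : prime p.

(** Multiples of [p], among them [0], become [1], so that products can run over full ranges. *)
Definition unit_part (j : nat) : nat := if (p %| j)%N then 1%N else j.

Definition unit_fact n : nat := (\prod_(j < n.+1) unit_part j)%N.

Lemma coprime_unit_part j : coprime p (unit_part j).
Proof.
rewrite /unit_part; case: ifP => pj; first exact: coprimen1.
by rewrite prime_coprime // pj.
Qed.

Lemma unit_part_period k i : unit_part (p * k + i) = unit_part i %[mod p].
Proof.
rewrite /unit_part dvdn_addr ?dvdn_mulr //; case: ifP => // _.
by rewrite mulnC modnMDl.
Qed.

(** Moving the window by one replaces the factor at [x] by that at [x + p], which is congruent to
    it; the window at [0] is Wilson's theorem. *)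
Lemma wilson_window x : (p %| (\prod_(i < p) unit_part (x + i)).+1)%N.
Proof.
have p_gt1 := prime_gt1 p_prime.
elim: x => [|x IH].
  have -> : (\prod_(i < p) unit_part (0 + i) = p.-1`!)%N.
    rewrite fact_prod -(big_mkord xpredT (fun i => unit_part (0 + i))).
    rewrite big_ltn ?prime_gt0 //.
    rewrite /unit_part dvdn0 mul1n prednK ?prime_gt0 //.
    rewrite big_nat_cond [RHS]big_nat_cond; apply: eq_bigr => i /andP[/andP[i0 ltip] _].
    by rewrite add0n gtnNdvd.
  by rewrite -Wilson.
have win : (unit_part x * \prod_(i < p) unit_part (x.+1 + i) =
   (\prod_(i < p) unit_part (x + i)) * unit_part (x + p))%N.
  rewrite -(big_ord_recr p (fun i => unit_part (x + i))) big_ord_recl addn0.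
  by congr (_ * _)%N; apply: eq_bigr => i _; rewrite /= /bump add1n addSnnS.
rewrite -(Gauss_dvdr _ (coprime_unit_part x)) mulnS win.
have := unit_part_period 1 x; rewrite muln1 addnC => ux.
rewrite /dvdn -modnDmr -modnMmr ux modnMmr modnDmr [(_ * unit_part x)%N]mulnC -mulnS.
by rewrite -/(dvdn _ _) dvdn_mull.
Qed.

(** The sign turns the ratio of consecutive values, [-1] modulo [p] by Wilson, into [1]. *)
Definition signed_unit_fact (x k : nat) : int :=
  (-1) ^+ k * (unit_fact (p * k + x))%:Z.

Definition step (x k : nat) : int :=
  - (\prod_(i < p) unit_part (p * k + x.+1 + i))%N%:Z.

Lemma signed_unit_factS x k :
  signed_unit_fact x k.+1 = signed_unit_fact x k * step x k.
Proof.
rewrite /signed_unit_fact /step /unit_fact.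
have -> : (p * k.+1 + x).+1 = ((p * k + x).+1 + p)%N by rewrite mulnS; lia.
by rewrite addnS big_split_ord /= PoszM exprS; ring.
Qed.

(** Whether [p] divides [p * l + i] does not depend on [l], so the function is either constant or
    affine of slope [p]. *)
Lemma diff_unit_part n i k :
  ((p ^ n)%N %| diff n (fun l => (unit_part (p * l + i))%:Z) k)%Z.
Proof.
have [pi|npi] := boolP (p %| i)%N.
  rewrite (eq_diff _ (g := fun=> 1)) => [|l]; last first.
    by rewrite /unit_part dvdn_addr ?dvdn_mulr // pi.
  by case: n => [|n]; rewrite ?dvd1z // diff_const dvdz0.
rewrite (eq_diff _ (g := fun l => (p * l + i)%N%:Z)) => [|l]; last first.
  by rewrite /unit_part dvdn_addr ?dvdn_mulr // (negbTE npi).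
case: n => [|n]; first by rewrite dvd1z.
rewrite diffSr (eq_diff _ (g := fun=> p%:Z)) => [|l]; last first.
  by rewrite mulnS !PoszD; ring.
by case: n => [|n]; rewrite ?expn1 ?diff_const ?dvdz0.
Qed.

Lemma diff_prod_unit_part x r n k :
  ((p ^ n)%N %| diff n (fun l => (\prod_(i < r) unit_part (p * l + x + i))%N%:Z) k)%Z.
Proof.
elim: r n k => [|r IH] n k.
  rewrite (eq_diff _ (g := fun=> 1)) => [|l]; last by rewrite big_ord0.
  by case: n => [|n]; rewrite ?dvd1z // diff_const dvdz0.
rewrite (eq_diff _ (g := fun l => (\prod_(i < r) unit_part (p * l + x + i))%N%:Z *
   (unit_part (p * l + (x + r)))%:Z)) => [|l]; last first.
  by rewrite big_ord_recr /= PoszM addnA.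
apply: dvdz_diffM => i j k' l' <-; rewrite expnD PoszM.
by apply: dvdz_mul; [apply: IH | apply: diff_unit_part].
Qed.

Lemma diff_step_sub1 x n k :
  ((p ^ maxn 1 n)%N %| diff n (fun l => step x l - 1) k)%Z.
Proof.
case: n => [|n].
  rewrite expn1 /step /= -opprD rpredN addrC.
  by have := wilson_window (p * k + x.+1); rewrite dvdzE.
rewrite maxnC (maxn_idPl _) //.
rewrite (diffD n.+1 (step x) (fun=> -1)) diff_const addr0 diffN rpredN.
exact: diff_prod_unit_part.
Qed.

(* One difference brings out a factor [step - 1], divisible by [p]; the next one
   may differentiate this factor without any gain, as it is a polynomial in
   [p * k]: hence half a power of [p] per difference. *)
Lemma diff_signed_unit_fact x n k :
  ((p ^ uphalf n)%N %| diff n (signed_unit_fact x) k)%Z.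
Proof.
elim/ltn_ind: n k => -[|n] IH k; first by rewrite dvd1z.
rewrite diffSr (eq_diff _ (g := fun l => (step x l - 1) * signed_unit_fact x l)) => [|l].
  apply: dvdz_diffM => i j k' l' ij.
  apply: (@dvdz_trans (p ^ maxn 1 i * p ^ uphalf j)%N).
    by rewrite -expnD dvdzE dvdn_exp2l //; lia.
  by rewrite PoszM; apply: dvdz_mul; [apply: diff_step_sub1 | apply: IH; lia].
by rewrite signed_unit_factS; ring.
Qed.

(** At most [m] of the [a] differences can fall on the binomial; the others each bring half a power
    of [p]. *)
Lemma diff_bin_signed_unit_fact x a m k :
  ((p ^ (a./2 - m./2))%N %|
    diff a (fun l => 'C(l, m)%:Z * signed_unit_fact x l) k)%Z.
Proof.
apply: dvdz_diffM => i j k' l' ij; rewrite diff_bin.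
case: leqP => lim; last by rewrite mul0r dvdz0.
apply: dvdz_mull; apply: dvdz_trans (diff_signed_unit_fact _ _ _).
by rewrite dvdzE dvdn_exp2l //; lia.
Qed.

End UnitFactorial.

(** * Valuations of the denominators *)

Section FactorialValuation.
Local Open Scope nat_scope.

Variable p : nat.
Hypothesis p_prime : prime p.

Lemma fact_unit_fact n : n`! = p ^ (n %/ p) * (n %/ p)`! * unit_fact p n.
Proof.
have p_gt0 := prime_gt0 p_prime.
elim: n => [|n IH].
  by rewrite div0n /unit_fact big_ord1 /unit_part dvdn0.
rewrite factS IH /unit_fact [in RHS]big_ord_recr /= -/(unit_fact p n) /unit_part.
rewrite divnS //; case: ifP => pn; rewrite ?add1n ?add0n; last by lia.
have := divnK pn; rewrite divnS // pn add1n => nE.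
by rewrite expnS factS -{1}nE; lia.
Qed.

Lemma logn_unit_fact n : logn p (unit_fact p n) = 0.
Proof.
apply: logn_coprime; rewrite /unit_fact.
apply: (big_ind (coprime p)) => [|x y|i _]; first exact: coprimen1.
  by rewrite coprimeMr => -> ->.
exact: coprime_unit_part.
Qed.

Lemma logn_fact_div n : logn p n`! = n %/ p + logn p (n %/ p)`!.
Proof.
have uf0 : 0 < unit_fact p n.
  apply: prodn_gt0 => i; rewrite /unit_part.
  by case: (posnP i) => [->|i_gt0]; rewrite ?dvdn0 //; case: ifP.
rewrite fact_unit_fact !lognM ?muln_gt0 ?expn_gt0 ?fact_gt0 ?(prime_gt0 p_prime) //.
by rewrite logn_unit_fact addn0 pfactorK.
Qed.

Lemma logn_factD x y : logn p x`! + logn p y`! <= logn p (x + y)`!.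
Proof.
rewrite -lognM ?fact_gt0 //; apply: dvdn_leq_log; rewrite ?fact_gt0 //.
by rewrite -(bin_fact (leq_addr y x)) addKn dvdn_mull.
Qed.

Lemma leq_logn_fact x y : x <= y -> logn p x`! <= logn p y`!.
Proof. by move=> /subnKC <-; apply: leq_trans (leq_addr _ _) (logn_factD _ _). Qed.

(** The valuation of e^u u!, which the [u]-th power of c_(e-1) contributes to the denominator. *)
Definition part_val e u := u * logn p e + logn p u`!.

(* For [p = 3] and [e = 9], the inequality of [double_logn_le] fails. *)
Definition ordinary e := [&& 1 < e, e != p & (p, e) != (3, 9)].

(** A number x such that x + v(x!), the valuation of (px)!, bounds [part_val], while 2px stays
    within u e for ordinary [e]. *)
Definition part_size e u := if p %| e then u * logn p e else u %/ p.

Hypothesis p_gt2 : 2 < p.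

Lemma part_val_le e u : 0 < e ->
  part_val e u <= part_size e u + logn p (part_size e u)`!.
Proof.
rewrite /part_val /part_size => e_gt0; case: ifP => pe.
  rewrite leq_add2l leq_logn_fact // leq_pmulr //.
  by rewrite logn_gt0 mem_primes p_prime e_gt0 pe.
by rewrite -logn_fact_div logn_coprime ?muln0 // prime_coprime ?pe.
Qed.

(** With e = c p^h this reads 2h <= c p^(h-1): exponential growth settles large h, and [ordinary]
    excludes the small cases that fail. *)
Lemma double_logn_le e : ordinary e -> p %| e -> 2 * p * logn p e <= e.
Proof.
move=> /and3P[e_gt1 nep ne39] pe.
have [c pc eE] := pfactor_coprime p_prime (ltnW e_gt1).
set h := logn p e in eE *.
have h_gt0 : 0 < h by rewrite /h logn_gt0 mem_primes p_prime pe (ltnW e_gt1).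
have c_gt0 : 0 < c by rewrite lt0n; apply/eqP => c0; move: e_gt1; rewrite eE c0.
case: h h_gt0 eE => // -[_|h _] eE.
  have c_gt1 : c != 1 by apply: contra nep => /eqP c1; rewrite eE c1 mul1n expn1.
  by rewrite eE expn1 muln1 leq_mul2r; lia.
suff : 2 * h.+2 <= c * p ^ h.+1 by rewrite eE (expnS p h.+1); nia.
have [p3|np3] := eqVneq p 3; last first.
  have p4 : p != 4 by apply/eqP => p4; move: p_prime; rewrite p4.
  have p5 : 5 <= p by lia.
  suff : 2 * h.+2 <= p ^ h.+1 by nia.
  by elim: (h) => [|k IH]; [rewrite expn1; lia | rewrite expnS; nia].
case: h eE => [|h] eE.
  have c_gt1 : c != 1 by apply: contra ne39 => /eqP c1; rewrite eE c1 p3.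
  by rewrite p3; lia.
suff : 2 * h.+3 <= p ^ h.+2 by nia.
by rewrite p3; elim: (h) => [|k IH] //; rewrite expnS; nia.
Qed.

Lemma part_size_le e u : ordinary e -> 2 * p * part_size e u <= u * e.
Proof.
move=> eo; rewrite /part_size; case: ifP => [pe|npe].
  by rewrite mulnCA leq_mul2l double_logn_le ?orbT.
by have /and3P[e_gt1 _ _] := eo; have := leq_trunc_div u p; nia.
Qed.

Variables (N : nat) (U : nat -> nat).

(** The bounds on single parts add up because x + v(x!) is superadditive. *)
Lemma sum_part_val (P : pred nat) :
  (forall i, i < N -> P i -> ordinary i.+2) ->
  exists2 x, \sum_(i < N | P i) part_val i.+2 (U i) <= x + logn p x`!
           & 2 * p * x <= \sum_(i < N | P i) U i * i.+2.
Proof.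
move=> Pord; exists (\sum_(i < N | P i) part_size i.+2 (U i)); last first.
  by rewrite big_distrr; apply: leq_sum => i Pi; apply/part_size_le/Pord.
apply: (big_ind2 (fun y x => y <= x + logn p x`!)) => // [y1 x1 y2 x2 le1 le2|i _].
  by have := logn_factD x1 x2; lia.
exact: part_val_le.
Qed.

(** The index [p - 2] is that of c_(p-1), whose exponent alone varies in the sum. *)
Definition rest_gam := \prod_(i < N | (i : nat) != p - 2) (i.+2 ^ U i * (U i)`!).
Definition rest_size := \sum_(i < N | (i : nat) != p - 2) U i * i.+2.
Definition rest_wt := \sum_(i < N | (i : nat) != p - 2) U i * i.+1.

Lemma logn_rest_gam :
  logn p rest_gam = \sum_(i < N | (i : nat) != p - 2) part_val i.+2 (U i).
Proof.
rewrite /rest_gam /part_val.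
suff : 0 < \prod_(i < N | (i : nat) != p - 2) (i.+2 ^ U i * (U i)`!) /\
  logn p (\prod_(i < N | (i : nat) != p - 2) (i.+2 ^ U i * (U i)`!)) =
  \sum_(i < N | (i : nat) != p - 2) part_val i.+2 (U i) by case.
apply: (big_ind2 (fun y x => 0 < y /\ logn p y = x)) =>
  [|y1 x1 y2 x2 [y1p <-] [y2p <-]|i _].
- by rewrite logn1.
- by rewrite muln_gt0 y1p y2p lognM.
by rewrite muln_gt0 expn_gt0 fact_gt0 lognM ?expn_gt0 ?fact_gt0 // lognX.
Qed.

(* The exception is that of the powers of [c_8] for [p = 3]. *)
Lemma logn_rest_gam_dichotomy :
  logn p rest_gam <= uphalf ((rest_size - 2) %/ p) + logn p ((rest_size - 2) %/ p)`!
  \/ p = 3 /\ rest_wt = U 7 * 8.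
Proof.
rewrite logn_rest_gam; set m := _ %/ p.
have mP y : p * y + 2 <= rest_size -> y <= m.
  by move=> ley; rewrite /m leq_divRL ?prime_gt0 // mulnC; move: ley; clear; lia.
move: m mP => m mP.
have [/andP[/eqP p3 ltN]|nine] := boolP ((p == 3) && (7 < N)); last first.
  left; have [i ltiN ip|x le1 le2] := @sum_part_val (fun i => i != p - 2).
    apply/and3P; split=> //.
      by apply: contra ip; move: p_gt2; clear; lia.
    by apply: contra nine; rewrite xpair_eqE; move: ltiN; clear; lia.
  apply: leq_trans le1 _; case: x le2 => [|x] le2; first by rewrite fact0 logn1.
  (* Here [x] stands for its predecessor, and 2p(x+1) >= p(2x+1) + 2. *)
  have mx : 2 * x + 1 <= m.
    by apply: mP; apply: leq_trans le2; move: p_gt2; clear; nia.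
  apply: leq_add; first by move: mx; clear; lia.
  by apply: leq_logn_fact; move: mx; clear; lia.
(* For p = 3, the powers of c_8, with base 9, are split off as well. *)
pose P i := (i != p - 2) && (i != 7).
have [i _ /andP[i1 i7]|x le1 le2] := @sum_part_val P.
  apply/and3P; split=> //; first by apply: contra i1; move: p_gt2; clear; lia.
  by apply: contra i7; rewrite xpair_eqE; clear; lia.
have PE (F : nat -> nat) :
    \sum_(i < N | (i : nat) != p - 2) F i = F 7 + \sum_(i < N | P i) F i.
  by rewrite (bigD1 (Ordinal ltN)) //= p3.
have -> := PE (fun i => part_val i.+2 (U i)).
have sE := PE (fun i => U i * i.+2); rewrite -/rest_size in sE.
have logn9 : logn p 9 = 2 by rewrite p3.
rewrite /part_val logn9; set w := U 7 in sE *.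
(* Thus the contribution 2w + v(w!) of c_8^w equals w + v((3w)!). *)
have fw : logn p (3 * w)`! = w + logn p w`! by rewrite logn_fact_div p3 mulKn.
have bound : x + 3 * w <= m -> x + w <= uphalf m ->
    w * 2 + logn p w`! + \sum_(i < N | P i) part_val i.+2 (U i)
      <= uphalf m + logn p m`!.
  move=> /leq_logn_fact; move: (logn_factD x (3 * w)) fw le1; clear; lia.
have {}le2 : 6 * x + 9 * w <= rest_size.
  by rewrite sE; move: le2; rewrite p3; clear; lia.
rewrite p3 in mP; have [big|small] := leqP (6 * x + 9 * w + 2) rest_size.
  left; have mx : 2 * x + 3 * w <= m by apply: mP; move: big; clear; lia.
  by apply: bound; move: mx; clear; lia.
have [x0|x_gt0] := posnP x; last first.
  left; have mx : 2 * x + 3 * w - 1 <= m by apply: mP; move: x_gt0 le2; clear; lia.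
  by apply: bound; move: mx x_gt0; clear; lia.
right; split=> //; rewrite /rest_wt (PE (fun i => U i * i.+1)) -/w.
(* Each remaining indeterminate has size at least 2, so none occurs. *)
have rest1 : \sum_(i < N | P i) U i * i.+2 <= 1.
  by move: small; rewrite sE x0; clear; lia.
rewrite big1 ?addn0 // => i Pi.
by move: rest1; rewrite (bigD1 i) //=; case: (U i) => // y; clear; lia.
Qed.

(** In the exceptional case the weight is a multiple of 8, hence of p - 1 = 2. *)
Lemma logn_rest_gam_le : rest_wt != 0 %[mod p.-1] ->
  logn p rest_gam <= uphalf ((rest_size - 2) %/ p) + logn p ((rest_size - 2) %/ p)`!.
Proof.
case: logn_rest_gam_dichotomy => // -[-> ->].
by rewrite -modnMmr /= muln0 mod0n.
Qed.

End FactorialValuation.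

(** * Truncated power series and Lagrange inversion *)

Section TruncatedSeries.
Variable A : comNzRingType.
Implicit Types p q r s f g : {poly A}.

(** Congruence modulo X^L with an explicit quotient, which turns many compatibilities into ring
    identities. *)
Definition eqX L p q := exists r, p = q + r * 'X^L.

Lemma eqXP L p q : eqX L p q <-> forall i, (i < L)%N -> p`_i = q`_i.
Proof.
split=> [[r ->] i ltiL|eqpq]; first by rewrite coefD coefMXn ltiL addr0.
exists (drop_poly L (p - q)); apply/polyP => i.
rewrite coefD coefMXn; case: ltnP => [/eqpq ->|leLi]; first by rewrite addr0.
by rewrite coef_drop_poly subnK // coefB addrC subrK.
Qed.

Lemma eqX_refl L p : eqX L p p.
Proof. by exists 0; rewrite mul0r addr0. Qed.

Lemma eqX_sym L p q : eqX L p q -> eqX L q p.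
Proof. by case=> r ->; exists (- r); ring. Qed.

Lemma eqX_trans L q p r : eqX L p q -> eqX L q r -> eqX L p r.
Proof. by move=> [a ->] [b ->]; exists (a + b); ring. Qed.

Lemma eqX_le L1 L2 p q : (L1 <= L2)%N -> eqX L2 p q -> eqX L1 p q.
Proof. by move=> le12 /eqXP eqpq; apply/eqXP => i lti; apply: eqpq; lia. Qed.

Lemma eqXD L p q r s : eqX L p q -> eqX L r s -> eqX L (p + r) (q + s).
Proof. by move=> [a ->] [b ->]; exists (a + b); ring. Qed.

Lemma eqXMn L k p q : eqX L p q -> eqX L (p *+ k) (q *+ k).
Proof. by move=> [a ->]; exists (a *+ k); rewrite mulrnDl mulrnAl. Qed.

Lemma eqXM L p q r s : eqX L p q -> eqX L r s -> eqX L (p * r) (q * s).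
Proof.
by move=> [a ->] [b ->]; exists (a * s + q * b + a * b * 'X^L); ring.
Qed.

Lemma eqX_exp L k p q : eqX L p q -> eqX L (p ^+ k) (q ^+ k).
Proof.
move=> eqpq; elim: k => [|k IH]; first by rewrite !expr0; apply: eqX_refl.
by rewrite !exprS; apply: eqXM.
Qed.

Lemma eqX_mulXI L p q : eqX L.+1 ('X * p) ('X * q) -> eqX L p q.
Proof.
by move=> /eqXP eqpq; apply/eqXP => i ltiL; have := eqpq i.+1 ltiL; rewrite !coefXM.
Qed.

Lemma eqX_deriv L p q : eqX L.+1 p q -> eqX L p^`() q^`().
Proof.
by move=> /eqXP eqpq; apply/eqXP => i ltiL; rewrite !coef_deriv eqpq.
Qed.

Lemma eqX_compl L p q g : eqX L p q -> eqX L (p \Po ('X * g)) (q \Po ('X * g)).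
Proof.
move=> [r ->]; exists ((r \Po ('X * g)) * g ^+ L).
by rewrite comp_polyD comp_polyM comp_Xn_poly exprMn; ring.
Qed.

Lemma eqX_compr L p f g : eqX L f g -> eqX L (p \Po f) (p \Po g).
Proof.
move=> eqfg; elim/poly_ind: p => [|p a IH].
  by rewrite !comp_poly0; apply: eqX_refl.
by rewrite !comp_poly_MXaddC; apply: eqXD (eqX_refl _ _); apply: eqXM.
Qed.

Lemma eqX_inv L p q r : eqX L (p * q) 1 -> eqX L (p * r) 1 -> eqX L q r.
Proof.
move=> pq1 pr1; apply: (@eqX_trans _ (q * (p * r))).
  by rewrite -{1}[q]mulr1; apply: eqXM (eqX_refl _ _) (eqX_sym pr1).
rewrite mulrCA mulrA -{2}[r]mul1r; exact: eqXM (eqX_refl _ _).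
Qed.

(** The derivative of W^(-e), with [V] in place of 1/W; differentiating costs one order of
    precision. *)
Lemma deriv_inverse L W V e : eqX L.+1 (W * V) 1 ->
  eqX L ((W^`() * V ^+ e.+1) *+ e) (- (V ^+ e)^`()).
Proof.
move=> WV1; have := eqX_deriv WV1; rewrite derivM derivC => dWV.
have {}WV1 := eqX_le (leqnSn L) WV1.
case: e => [|e]; first by rewrite mulr0n expr0 derivC oppr0; apply: eqX_refl.
rewrite deriv_exp /= -mulNrn; apply: eqXMn.
apply: (@eqX_trans _ ((- (V^`() * V ^+ e)) * (W * V)
                      + (W^`() * V + W * V^`()) * V ^+ e.+1)).
  by rewrite !exprS; apply: (eqX_trans (eqX_refl _ _)); exists 0; ring.
rewrite -[X in eqX _ _ X]addr0; apply: eqXD.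
  by rewrite -{2}[- _]mulr1; apply: eqXM WV1; apply: eqX_refl.
by rewrite -[X in eqX _ _ X](mul0r (V ^+ e.+1)); apply: eqXM => //; apply: eqX_refl.
Qed.

Hypothesis A_torsion_free : forall k (x : A), x *+ k.+1 = 0 -> x = 0.

(** With u = X W, this is the residue of u^(k-n-1) du; any exponent but -1 gives an exact form
    d(u^(k-n))/(k-n), without residue. *)
Lemma residue_exp W V n k : eqX n.+2 (W * V) 1 ->
  ((('X * W) ^+ k * ('X * W)^`()) * V ^+ n.+1)`_n = (k == n)%:R.
Proof.
move=> WV1; rewrite derivM derivX mul1r exprMn -!mulrA coefXnM.
case: ltngtP => // [ltkn|->].
  set e := (n - k)%N; have en : (n = k + e)%N by rewrite /e; lia.
  have eqC : eqX n.+1 (W ^+ k * ((W + 'X * W^`()) * V ^+ n.+1))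
      (V ^+ e + 'X * (W^`() * V ^+ e.+1)).
    have WVn : eqX n.+1 (W * V) 1 by apply: eqX_le WV1.
    have -> : V ^+ n.+1 = V ^+ k * V ^+ e.+1 by rewrite -exprD; congr (_ ^+ _); lia.
    apply: (@eqX_trans _ ((W * V) ^+ k * (W * V * V ^+ e + 'X * (W^`() * V ^+ e.+1)))).
      by exists 0; rewrite exprMn !exprS; ring.
    rewrite -[X in eqX _ _ X]mul1r; apply: eqXM.
      by rewrite -(expr1n _ k); apply: eqX_exp.
    apply: eqXD (eqX_refl _ _); rewrite -{2}[V ^+ e]mul1r.
    by apply: eqXM (eqX_refl _ _).
  have e_gt0 : (0 < e)%N by lia.
  have -> : (W ^+ k * ((W + 'X * W^`()) * V ^+ n.+1))`_e =
     (V ^+ e + 'X * (W^`() * V ^+ e.+1))`_e.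
    by move/eqXP: eqC; apply; lia.
  have /eqXP dV := deriv_inverse e WV1.
  (* Exactness is available only after multiplication by [e]. *)
  case: {-1}e (erefl e) e_gt0 => // e' ee' _; apply: (@A_torsion_free e').
  have := dV e' ltac:(lia); rewrite coefMn coefN coef_deriv -ee'.
  rewrite coefD coefXM ee' /= mulrnDl => ->.
  by rewrite addrN.
have := (proj1 (eqXP _ _ _) WV1) 0%N isT.
rewrite subnn -!horner_coef0 !hornerM !horner_exp hornerD hornerM hornerX hornerC.
rewrite mul0r addr0 => WV0.
by rewrite exprS [W.[0] * _]mulrA WV0 mul1r -exprMn WV0 expr1n.
Qed.

(* Lagrange inversion: if [B (t * W) = W], i.e. [B] is [u / t(u)] for
   [u(t) = t * W(t)], then [B_n] is read off the residue of [dB / u ^ n]. *)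
Lemma lagrange_inversion W V B n : eqX n.+2 (W * V) 1 -> eqX n.+2 (B \Po ('X * W)) W ->
  B`_n.+1 *+ n = - (V ^+ n)`_n.+1.
Proof.
move=> WV1 BW; apply/eqP; rewrite -subr_eq0 opprK.
(* Multiplication by [n.+1] turns both terms into coefficients of derivatives. *)
apply/eqP/(@A_torsion_free n); rewrite mulrnDl mulrnAC.
have := eqX_deriv BW; rewrite deriv_comp => dBW.
have : eqX n.+1 (((B^`() \Po ('X * W)) * ('X * W)^`()) * V ^+ n.+1)
          (W^`() * V ^+ n.+1) by apply: eqXM (eqX_refl _ _).
move=> /eqXP /(_ n (ltnSn n)).
have -> : (((B^`() \Po ('X * W)) * ('X * W)^`()) * V ^+ n.+1)`_n = B`_n.+1 *+ n.+1.
  rewrite comp_polyE !mulr_suml coef_sum.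
  under eq_bigr => i _ do rewrite -!scalerAl coefZ (residue_exp i WV1) mulr_natr mulrb.
  rewrite -coef_deriv; have [ltn|gen] := ltnP n (size B^`()).
    rewrite (bigD1 (Ordinal ltn)) //= eqxx big1 ?addr0 // => i.
    by rewrite -val_eqE /= => /negbTE ->.
  rewrite nth_default // big1 // => i _; case: eqP => // ein.
  by have := ltn_ord i; lia.
move=> ->; rewrite -coefMn.
have /eqXP -> // := deriv_inverse n WV1.
by rewrite coefN coef_deriv addNr.
Qed.

End TruncatedSeries.

(** * Truncations of the operations on coefficient sequences *)

Section TruncatedSeriesOperations.
Variable A : comNzRingType.
Implicit Types f g : nat -> A.

Lemma trunc_sermul L f g : eqX L (\poly_(i < L) f i * \poly_(i < L) g i)
  (\poly_(i < L) sermul f g i).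
Proof.
apply/eqXP => i ltiL; rewrite coefM coef_poly ltiL; apply: eq_bigr => j _.
by rewrite !coef_poly !ifT //; have := ltn_ord j; lia.
Qed.

Lemma trunc_serexp L g k : eqX L ((\poly_(i < L) g i) ^+ k)
  (\poly_(i < L) serexp g k i).
Proof.
elim: k => [|k IH].
  by apply/eqXP => i ltiL; rewrite expr0 coef_poly ltiL coef1.
rewrite exprS; apply: eqX_trans (eqXM (eqX_refl _ _) IH) _.
exact: trunc_sermul.
Qed.

Lemma trunc_sercomp L f g : g 0%N = 0 ->
  eqX L (\poly_(i < L) f i \Po \poly_(i < L) g i) (\poly_(i < L) sercomp f g i).
Proof.
move=> g0; apply/eqXP => i ltiL; rewrite coef_comp_poly coef_poly ltiL /sercomp.
have -> : \sum_(k < i.+1) f k * serexp g k i = \sum_(k < L) f k * serexp g k i.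
  rewrite (big_ord_widen L (fun k => f k * serexp g k i) ltiL).
  rewrite big_mkcond /=; apply: eq_bigr => k _.
  by case: ltnP => // ltik; rewrite serexp_order ?mulr0.
rewrite (big_ord_widen L (fun k => (\poly_(j < L) f j)`_k *
  ((\poly_(j < L) g j) ^+ k)`_i)) ?size_poly // big_mkcond /=.
apply: eq_bigr => k _; case: ltnP => [_|lek].
  rewrite coef_poly ltn_ord; congr (_ * _).
  by have /eqXP -> // := trunc_serexp L g k; rewrite coef_poly ltiL.
have : (\poly_(j < L) f j)`_k = 0 by rewrite nth_default.
by rewrite coef_poly ltn_ord => ->; rewrite mul0r.
Qed.

Lemma trunc_mulX L f : f 0%N = 0 ->
  \poly_(i < L.+1) f i = 'X * \poly_(i < L) f i.+1.
Proof.
by move=> f0; apply/polyP => -[|i]; rewrite coefXM !coef_poly //= ltnS.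
Qed.

Lemma trunc_serX L : eqX L (\poly_(i < L) serX i) ('X : {poly A}).
Proof. by apply/eqXP => i ltiL; rewrite coef_poly ltiL coefX. Qed.

Lemma trunc_sercomp_id L f g : g 0%N = 0 -> sercomp f g =1 serX ->
  eqX L (\poly_(i < L) f i \Po \poly_(i < L) g i) 'X.
Proof.
move=> g0 fg; apply: eqX_trans (trunc_sercomp L f g0) _.
by rewrite (eq_poly _ (fun i _ => fg i)); apply: trunc_serX.
Qed.

(* [t] has a right inverse [s], which associativity identifies with [f]: so [t]
   is also a left inverse of [f]. *)
Lemma trunc_compinv_left L f : f 0%N = 0 -> f 1%N = 1 ->
  eqX L.+1 (\poly_(i < L.+1) sercompinv f i \Po \poly_(i < L.+1) f i) 'X.
Proof.
move=> f0 f1; set t := sercompinv f; pose s := sercompinv t.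
have t0 : t 0%N = 0 by apply: sercompinv0.
have t1 : t 1%N = 1 by rewrite /t sercompinvE big_geq // subr0.
have s0 : s 0%N = 0 by apply: sercompinv0.
have ft := trunc_sercomp_id L.+1 t0 (sercomp_sercompinv f0 f1).
have ts := trunc_sercomp_id L.+1 s0 (sercomp_sercompinv t0 t1).
apply: eqX_trans _ (ts); apply: eqX_compr.
rewrite -{1}[\poly_(i < _) f i]comp_polyXr.
apply: eqX_trans (eqX_compr _ (eqX_sym ts)) _.
rewrite comp_polyA -[X in eqX _ _ X]comp_polyX.
by rewrite (trunc_mulX L s0); apply: eqX_compl.
Qed.

(** With D = t(u)/u, cancelling X in t(u(t)) = t gives W D(X W) = 1, while B D = 1 gives B(X W) D(X
    W) = 1; inverses are unique. *)
Lemma trunc_inverse_quotient L f : f 0%N = 0 -> f 1%N = 1 ->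
  eqX L (\poly_(i < L) serinv (fun k => sercompinv f k.+1) i \Po
     ('X * \poly_(i < L) f i.+1)) (\poly_(i < L) f i.+1).
Proof.
move=> f0 f1; set t := sercompinv f; set W := \poly_(i < L) f i.+1.
set B := \poly_(i < L) _; pose D := \poly_(i < L) t i.+1.
have t0 : t 0%N = 0 by apply: sercompinv0.
have t1 : t 1%N = 1 by rewrite /t sercompinvE big_geq // subr0.
have := trunc_compinv_left L f0 f1.
rewrite !trunc_mulX // -/W -/D comp_polyM comp_polyX -mulrA.
rewrite -[X in eqX _ _ X]mulr1 => /eqX_mulXI WD1.
apply: (@eqX_inv _ _ (D \Po ('X * W))); last by rewrite [X in eqX _ X]mulrC.
rewrite -comp_polyM -[X in eqX _ _ X]polyC1 -(comp_polyC 1 ('X * W)); apply: eqX_compl.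
apply: eqX_trans (trunc_sermul L _ _) _.
apply/eqXP => i ltiL; rewrite coef_poly ltiL coef1.
exact: (sermul_serinv (f := fun k => t k.+1) t1).
Qed.

(** The expansion of (1 + w)^(-e-1), by induction on [e], with its remainder. *)
Lemma neg_binomial e L (w : {poly A}) : exists r,
  (1 + w) ^+ e.+1 * (\sum_(d < L.+1) (-1) ^+ d *+ 'C(e + d, d) * w ^+ d)
    = 1 + r * w ^+ L.+1.
Proof.
elim: e => [|e [r IH]].
  exists ((-1) ^+ L); elim: L => [|L IH].
    by rewrite big_ord1 !bin0 !expr0 expr1; ring.
  rewrite big_ord_recr /= mulrDr IH add0n binn !exprS; ring.
(* By Pascal's rule, a factor 1 + w lowers [e], up to a boundary term. *)
have step M : (1 + w) * (\sum_(d < M.+1) (-1) ^+ d *+ 'C(e.+1 + d, d) * w ^+ d) =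
    \sum_(d < M.+1) (-1) ^+ d *+ 'C(e + d, d) * w ^+ d
    + (-1) ^+ M *+ 'C(e.+1 + M, M) * w ^+ M.+1.
  elim: M => [|M IHM]; first by rewrite !big_ord1 !bin0 !expr0 expr1; ring.
  rewrite big_ord_recr /= mulrDr IHM [in RHS]big_ord_recr /=.
  have -> : 'C(e.+1 + M.+1, M.+1) = ('C(e + M.+1, M.+1) + 'C(e.+1 + M, M))%N.
    by rewrite addSn binS addSnnS.
  rewrite !exprS; ring.
rewrite exprSr -mulrA step mulrDr IH.
exists (r + (1 + w) ^+ e.+1 * ((-1) ^+ L *+ 'C(e.+1 + L, L))); ring.
Qed.

(** As X divides [W - 1], the remainder vanishes modulo X^(L+1). *)
Lemma neg_binomial_inverse L e (W : {poly A}) : W`_0 = 1 ->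
  eqX L.+1 (W ^+ e.+1 *
    (\sum_(d < L.+1) (-1) ^+ d *+ 'C(e + d, d) * (W - 1) ^+ d)) 1.
Proof.
move=> W0; have [r] := neg_binomial e L (W - 1); rewrite addrC subrK => ->.
have [h ->] : exists h, W - 1 = 'X * h.
  exists (drop_poly 1 (W - 1)); rewrite mulrC -['X]expr1.
  rewrite -{1}[W - 1](poly_take_drop 1).
  suff -> : take_poly 1 (W - 1) = 0 by rewrite add0r.
  apply/polyP => -[|i]; rewrite coef_take_poly coef0 //=.
  by rewrite coefB coef1 W0 subrr.
by exists (r * h ^+ L.+1); rewrite exprMn; ring.
Qed.

Lemma expr_inverse L e (W V : {poly A}) : W`_0 = 1 -> eqX L.+1 (W * V) 1 ->
  eqX L.+1 (V ^+ e.+1)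
    (\sum_(d < L.+1) (-1) ^+ d *+ 'C(e + d, d) * (W - 1) ^+ d).
Proof.
move=> W0 WV1; apply: (@eqX_inv _ _ (W ^+ e.+1)).
  by rewrite -exprMn -(expr1n _ e.+1); apply: eqX_exp.
exact: neg_binomial_inverse.
Qed.

End TruncatedSeriesOperations.

(** * The coefficients of the universal Bernoulli numbers *)

Implicit Types (m : {cmonom nat}) (U : nat -> nat).

(** The quotient of [m] by a power of one indeterminate, meaningful when [e <= m k]. *)
Definition lower m k e : {cmonom nat} :=
  mkcmonom [fsfun i in finsupp m => (m i - (i == k) * e)%N | 0%N].

Lemma lowerE m k e i : lower m k e i = (m i - (i == k) * e)%N.
Proof. by rewrite cmE fsfun_fun; case: finsuppP. Qed.

Lemma lower_id m k : lower m k 0 = m.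
Proof. by apply/eqP/cmP => i; rewrite lowerE muln0 subn0. Qed.

Lemma lower_lower m k e1 e2 : lower (lower m k e1) k e2 = lower m k (e1 + e2).
Proof. by apply/eqP/cmP => i; rewrite !lowerE mulnDr subnDA. Qed.

Lemma mcoeff_mulU k (g : Qc) m :
  (<< ucm k >> * g)@_m = if (0 < m k)%N then g@_(lower m k 1) else 0.
Proof.
rewrite mcoeffMl msuppU1 big_seq_fset1 mcoeffUU.
case: ifP => mk.
  have eqm k2 : (mmul (ucm k) k2 == m) = (k2 == lower m k 1).
    apply/cmP/cmP => eqk i; have := eqk i.
      by rewrite cmM cmU lowerE eq_sym => <-; case: eqP => _ /=; lia.
    rewrite cmM cmU lowerE eq_sym => ->.
    by case: eqP => [<-|_] /=; rewrite ?muln1 ?subnKC // subn0.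
  have [kin|knot] := boolP (lower m k 1 \in msupp g).
    rewrite (big_fsetD1 _ kin) /= eqm eqxx mul1r big1_fset ?addr0 // => k2.
    by rewrite in_fsetD1 eqm => /andP[/negbTE ->].
  rewrite (mcoeff_outdom knot) big1_fset // => k2 k2in _; rewrite eqm.
  by case: eqP k2in knot => // ->  ->.
rewrite big1_fset // => k2 _ _; case: cmP => // /(_ k).
by rewrite cmM cmU eqxx => mk1; move: mk; rewrite -[m k]mk1.
Qed.

Lemma mcoeff_mulUX k e (g : Qc) m :
  (<< ucm k >> ^+ e * g)@_m = if (e <= m k)%N then g@_(lower m k e) else 0.
Proof.
elim: e m => [|e IH] m; first by rewrite expr0 mul1r lower_id.
rewrite exprS -mulrA mcoeff_mulU; case: ltnP => mk; last first.
  by rewrite ifF //; lia.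
rewrite IH lowerE eqxx lower_lower add1n.
by congr (if _ then _ else _); lia.
Qed.

(* [U i] is the exponent of [c_(i+1)], and [N] bounds the support of [U]. *)
Definition degN N U := (\sum_(i < N) U i)%N.
Definition wtN N U := (\sum_(i < N) U i * i.+1)%N.
Definition gamN N U := (\prod_(i < N) (i.+2 ^ U i * (U i)`!))%N.

Lemma gamN_gt0 N U : (0 < gamN N U)%N.
Proof. by apply: prodn_gt0 => i; rewrite muln_gt0 expn_gt0 fact_gt0. Qed.

Section Lower.
Variables (N k e : nat) (m : {cmonom nat}).
Hypotheses (ltkN : (k < N)%N) (lek : (e <= m k)%N).

Lemma lower_split (R : Type) (idx : R) (op : Monoid.com_law idx) (F : nat -> nat -> R) :
  \big[op/idx]_(i < N) F i (lower m k e i) =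
  op (F k (m k - e)%N) (\big[op/idx]_(i < N | (i : nat) != k) F i (m i)).
Proof.
rewrite (bigD1 (Ordinal ltkN)) //= lowerE eqxx mul1n; congr (op _ _).
by apply: eq_bigr => i; rewrite -val_eqE /= => ik; rewrite lowerE (negbTE ik) subn0.
Qed.

Lemma degN_lower : (degN N (lower m k e) + e)%N = degN N m.
Proof.
rewrite /degN (@lower_split _ _ addn (fun i x => x)).
by rewrite [RHS](bigD1 (Ordinal ltkN)) //= addnAC subnK.
Qed.

Lemma wtN_lower : (wtN N (lower m k e) + e * k.+1)%N = wtN N m.
Proof.
rewrite /wtN (@lower_split _ _ addn (fun i x => x * i.+1)%N).
by rewrite [RHS](bigD1 (Ordinal ltkN)) //= addnAC -mulnDl subnK.
Qed.
End Lower.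

Lemma gamN_lower N k m : (k < N)%N -> (0 < m k)%N ->
  gamN N m = (k.+2 * m k * gamN N (lower m k 1))%N.
Proof.
move=> ltkN mk; rewrite /gamN.
rewrite (@lower_split _ _ _ _ ltkN _ _ muln (fun i x => i.+2 ^ x * x`!)%N).
rewrite (bigD1 (Ordinal ltkN)) //= !mulnA; congr (_ * _)%N.
by rewrite subn1; case: (m k) mk => // x _; rewrite factS expnS /=; lia.
Qed.

Definition wpoly N : {poly Qc} := \poly_(i < N.+1) useries i.+1.

Lemma wpoly0 N : (wpoly N)`_0 = 1.
Proof. by rewrite coef_poly. Qed.

(** The multinomial theorem for u(t)/t - 1, peeling off one factor at a time. *)
Lemma mcoeff_wpolyX N m n d : (n <= N)%N -> (forall i, (N <= i)%N -> m i = 0%N) ->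
  (((wpoly N - 1) ^+ d)`_n)@_m =
    ((degN N m == d) && (wtN N m == n))%:R * (d`!%:R / (gamN N m)%:R).
Proof.
elim: d n m => [|d IH] n m lenN suppm.
  rewrite expr0 coef1; have [->|mn1] := eqVneq m (mone : {cmonom nat}).
    have z i : (mone : {cmonom nat}) i = 0%N by rewrite cm1.
    have -> : degN N (mone : {cmonom nat}) = 0%N by rewrite /degN big1.
    have -> : wtN N (mone : {cmonom nat}) = 0%N.
      by rewrite /wtN big1 // => i _; rewrite z.
    have -> : gamN N (mone : {cmonom nat}) = 1%N.
      by rewrite /gamN big1 // => i _; rewrite z.
    rewrite fact0 !mulr1n divr1 mulr1 eqxx [(0 == n)%N]eq_sym /=.
    by case: (n == 0)%N; rewrite ?mulr1n ?mulr0n ?mcoeff1 ?eqxx ?mcoeff0.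
  have /negbTE -> : ~~ ((degN N m == 0%N) && (wtN N m == n)).
    apply: contra mn1 => /andP[/eqP deg0 _]; apply/cmP => i; rewrite cm1.
    have [/suppm //|ltiN] := leqP N i.
    by apply/eqP; move/eqP: deg0; rewrite sum_nat_eq0 => /forallP/(_ (Ordinal ltiN)).
  rewrite mul0r; case: (n == 0)%N; rewrite ?mulr1n ?mulr0n ?mcoeff0 //.
  by rewrite mcoeff1 (negbTE mn1).
rewrite exprS coefM raddf_sum /=.
(* Taking c_j from the first factor accounts for the share of its exponent in the degree d + 1. *)
have term (j : 'I_n.+1) : ((wpoly N - 1)`_j * ((wpoly N - 1) ^+ d)`_(n - j))@_m =
   (((j : nat) != 0)%N * m j.-1)%N%:R * (((degN N m == d.+1) && (wtN N m == n))%:R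
     * (d`!%:R / (gamN N m)%:R)).
  rewrite coefB coef1 coef_poly ifT; last by have := ltn_ord j; lia.
  case: j => -[|j] /= ltj; first by rewrite subrr mul0r mcoeff0 !mul0r.
  rewrite subr0 -scalerAl mcoeffZ mcoeff_mulU /= mul1n.
  case: ltnP => [mj|]; last by rewrite leqn0 => /eqP ->; rewrite !mul0r mulr0.
  have ltjN : (j < N)%N by lia.
  rewrite IH; last 2 first.
  - lia.
  - by move=> i /suppm mi; rewrite lowerE mi.
  have dE := degN_lower ltjN mj; have wE := wtN_lower ltjN mj.
  have -> : (degN N (lower m j 1) == d) && (wtN N (lower m j 1) == (n - j.+1)%N)
      = (degN N m == d.+1) && (wtN N m == n) by rewrite -dE -wE; lia.
  rewrite (gamN_lower ltjN mj) !natrM; have := gamN_gt0 N (lower m j 1).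
  rewrite -!(Num.Theory.ltr0n rat) in mj *.
  move=> /Num.Theory.lt0r_neq0 g0; move/Num.Theory.lt0r_neq0: mj => m0.
  field; by rewrite g0 m0 -natrD Num.Theory.pnatr_eq0.
under eq_bigr do rewrite term.
rewrite -mulr_suml -natr_sum big_ord_recl /= mul0n add0n.
have [wn|] := eqVneq (wtN N m) n; last by rewrite !andbF !mul0r mulr0.
have -> : (\sum_(i < n) true * m i)%N = degN N m.
  under eq_bigr do rewrite mul1n.
  rewrite /degN (big_ord_widen N (fun i => m i) lenN) big_mkcond /=.
  apply: eq_bigr => i _; case: ltnP => // leni.
  apply/esym/eqP; rewrite -leqn0 leqNgt; apply/negP => mi.
  move: wn; rewrite /wtN (bigD1 i) //=; nia.
have [->|] := eqVneq (degN N m) d.+1; last by rewrite !mul0r mulr0.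
by rewrite !mul1r mulrA -natrM factS.
Qed.

(** The summand of the formula for hatB_n / n, with n recovered as the weight of [U]. *)
Definition tauN N U : rat := (-1) ^+ (degN N U).+1 *
  (wtN N U + degN N U - 2)`!%:R / (gamN N U)%:R.

Lemma degN_le_wtN N U : (degN N U <= wtN N U)%N.
Proof. by apply: leq_sum => i _; rewrite mulnS leq_addr. Qed.

Lemma mcoeff_coef_signM d k n m (q : {poly Qc}) :
  (((-1) ^+ d *+ k * q)`_n)@_m = (-1) ^+ d * k%:R * (q`_n)@_m.
Proof.
rewrite mulrnAl coefMn mcoeffMn -[LHS]mulr_natr [RHS]mulrAC; congr (_ * _).
rewrite -signr_odd -[in RHS]signr_odd.
by case: (odd d); rewrite ?expr1 ?expr0 ?mulN1r ?mul1r ?coefN ?mcoeffN.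
Qed.

(** Lagrange inversion at n - 1 requires dividing by n - 1, whence n > 1; in the expansion of
    V^(n-1), only the power whose exponent is the degree of [m] contributes. *)
Lemma mcoeff_hatB N m n : (1 < n <= N)%N -> (forall i, (N <= i)%N -> m i = 0%N) ->
  ((n%:R : rat)^-1 *: hatB n)@_m = (wtN N m == n)%:R * tauN N m.
Proof.
case: n => [|[|n]] // /andP[_ lenN] suppm.
set L := N.+1; pose W := wpoly N.
pose V := \sum_(d < L) (-1) ^+ d *+ 'C(0 + d, d) * (W - 1) ^+ d.
have WV : eqX L (W * V) 1.
  by rewrite -[W in W * _]expr1; apply: neg_binomial_inverse (wpoly0 N).
have tf k (x : Qc) : x *+ k.+1 = 0 -> x = 0.
  move=> /malgP xk; apply/malgP => i; have /eqP := xk i.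
  by rewrite mcoeffMn !mcoeff0 Num.Theory.mulrn_eq0 /= => /eqP.
have := @lagrange_inversion _ tf _ _ _ n.+1 (eqX_le _ WV)
  (eqX_le _ (@trunc_inverse_quotient _ L useries erefl erefl)).
move=> /(_ ltac:(lia) ltac:(lia)).
rewrite coef_poly ifT; last by rewrite /L; lia.
have /eqXP -> := expr_inverse n (wpoly0 N) WV; last by rewrite /L; lia.
set b := serinv _ _ => bE.
have -> : hatB n.+2 = (n.+2`!%:R : rat) *: b by [].
(* The degree is at most the weight, so the relevant power survives truncation. *)
have wn_deg : wtN N m = n.+2 -> (degN N m < L)%N.
  by move=> wn; have := degN_le_wtN N m; rewrite /L; lia.
have {}bE : b@_m *+ n.+1 = - ((wtN N m == n.+2)%:R * ((-1) ^+ degN N m *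
    'C(n + degN N m, degN N m)%:R * ((degN N m)`!%:R / (gamN N m)%:R))).
  have /(congr1 (mcoeff m)) := bE; rewrite mcoeffMn mcoeffN => ->; congr (- _).
  rewrite coef_sum raddf_sum /=.
  under eq_bigr => d _ do rewrite mcoeff_coef_signM mcoeff_wpolyX //.
  have [wn|_] := eqVneq (wtN N m) n.+2; last first.
    by rewrite mul0r big1 // => d _; rewrite andbF mul0r mulr0.
  rewrite (bigD1 (Ordinal (wn_deg wn))) //= eqxx big1 ?addr0 => [|d].
    by rewrite !mul1r.
  by rewrite -val_eqE /= eq_sym => /negbTE ->; rewrite mul0r mulr0.
rewrite /hatB scalerA mcoeffZ /tauN.
have {bE} -> : b@_m = - (n.+1%:R^-1 * (wtN N m == n.+2)%:R * ((-1) ^+ degN N m *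
    'C(n + degN N m, degN N m)%:R * ((degN N m)`!%:R / (gamN N m)%:R))).
  have n1 : n.+1%:R != 0 :> rat by rewrite Num.Theory.pnatr_eq0.
  apply: (mulIf n1); rewrite [LHS]mulr_natr; apply: (etrans bE).
  rewrite mulNr; congr (- _).
  by rewrite [RHS]mulrC -!mulrA mulVKf.
have [wn|_] := eqVneq (wtN N m) n.+2; last by rewrite mulr0 mul0r oppr0 mulr0 mul0r.
rewrite wn; have -> : (n.+2 + degN N m - 2 = n + degN N m)%N by lia.
have <- : ('C(n + degN N m, degN N m) * ((degN N m)`! * n`!) = (n + degN N m)`!)%N.
  by rewrite -(bin_fact (leq_addl n (degN N m))) addnK.
rewrite !factS !natrM exprS.
have : (gamN N m)%:R != 0 :> rat by rewrite Num.Theory.pnatr_eq0 -lt0n gamN_gt0.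
have : n.+1%:R != 0 :> rat by rewrite Num.Theory.pnatr_eq0.
have : n.+2%:R != 0 :> rat by rewrite Num.Theory.pnatr_eq0.
move: (n.+2%:R : rat) (n.+1%:R : rat) ((gamN N m)%:R : rat) => x y g x0 y0 g0.
move: (n`!%:R : rat) ((-1) ^+ degN N m : rat) ('C(n + degN N m, degN N m)%:R : rat).
by move: ((degN N m)`!%:R : rat) => s t z r; field; rewrite x0 y0 g0.
Qed.

(** * The coefficients of the alternating sum *)

Lemma padic_val_ge0 p k : padic_val_ge p k 0.
Proof. by []. Qed.

(** The fraction may be reducible, so valuations are compared through cross multiplication. *)
Lemma padic_val_ge_frac p k (x : int) (g : nat) : prime p -> (0 < g)%N ->
  ((p ^ (k + logn p g))%N %| x)%Z -> padic_val_ge p k (x%:~R / g%:R).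
Proof.
move=> p_prime g_gt0 px /eqP q0; set q := _ / _ in q0 *.
have x0 : x != 0 by apply: contra q0 => /eqP x0; rewrite /q x0 mul0r.
have g0 : g%:R != 0 :> rat by rewrite Num.Theory.pnatr_eq0 -lt0n.
have qE : (numq q * g%:Z = x * denq q)%R.
  apply/eqP; rewrite -(eqr_int rat) !intrM -[X in X * g%:~R]/((numq q)%:~R).
  rewrite numqE -pmulrn mulrAC; apply/eqP; congr (_ * _).
  by rewrite /q divfK.
have : (logn p `|numq q| + logn p g = logn p `|x| + logn p `|denq q|)%N.
  rewrite -!lognM ?absz_gt0 ?numq_eq0 ?denq_neq0 //.
  by have := congr1 absz qE; rewrite !abszM absz_nat => ->.
have : (k + logn p g <= logn p `|x|)%N by rewrite -pfactor_dvdn ?absz_gt0.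
by rewrite /padic_val; lia.
Qed.

Lemma cmonom_bound (m : {cmonom nat}) : exists N, forall i, (N <= i)%N -> m i = 0%N.
Proof.
exists (\max_(i <- finsupp m) i).+1 => i lei; apply/eqP; rewrite cmE_eq0.
by apply: contraL lei => im; rewrite -ltnNge ltnS; apply: leq_bigmax_seq im _.
Qed.

Lemma wt_degN N (U : nat -> nat) : (wtN N U + degN N U = \sum_(i < N) U i * i.+2)%N.
Proof.
rewrite -big_split; apply: eq_bigr => i _ /=; rewrite !mulnS; lia.
Qed.

(** The factor p^(v-s) (v-s)! cancels against the part of [gamN] due to c_(p-1), and p^mu mu! does
    not depend on [s]; the rest is, up to sign, the function to be differenced. *)
Lemma fact_sub_mul (p q b s v mu : nat) :
  prime p -> (b < p)%N -> q = (v + mu)%N -> (s <= v)%N ->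
  (p * q + b - s * p)`! = (p ^ (v - s) * (v - s)`! *
   (p ^ mu * mu`! * ('C(q - s, mu) * unit_fact p (p * (q - s) + b))))%N.
Proof.
move=> p_prime ltbp -> les.
have -> : (p * (v + mu) + b - s * p = p * (v + mu - s) + b)%N by nia.
rewrite (fact_unit_fact p_prime) (mulnC p) divnMDl ?prime_gt0 // (divn_small ltbp) addn0.
have E : (v + mu - s = v - s + mu)%N by lia.
rewrite E -(bin_fact (leq_addl (v - s) mu)) addnK expnD; ring.
Qed.

Section Coefficient.
Variables (p N a n : nat) (m : {cmonom nat}).
Hypotheses (p_prime : prime p) (p_gt2 : (2 < p)%N) (a_lt_n : (a < n)%N).
Hypotheses (a_gt0 : (0 < a)%N) (n_nmod : n <> 0 %[mod p.-1]).
Hypotheses (leN : (n + a * p.-1 <= N)%N) (ltpN : (p <= N)%N).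
Hypothesis suppm : forall i, (N <= i)%N -> m i = 0%N.

Let k0 := (p - 2)%N.
Let v := m k0.

Let ltk0N : (k0 < N)%N. Proof. by rewrite /k0; lia. Qed.

(** Since c_(p-1) has weight p - 1, all terms share one total weight. *)
Lemma mcoeff_term r : (r <= a)%N ->
  ('C(a, r)%:R * (-1) ^+ r * c p.-1 ^+ (a - r)
     * (((n + r * p.-1)%:R : rat)^-1 *: hatB (n + r * p.-1)))@_m =
  if (a - r <= v)%N && (wtN N m == n + a * p.-1)%N then
    'C(a, r)%:R * (-1) ^+ r * tauN N (lower m k0 (a - r)) else 0.
Proof.
move=> lera; set h := _ *: _.
have -> : ('C(a, r)%:R * (-1) ^+ r * c p.-1 ^+ (a - r) * h)@_m =
   'C(a, r)%:R * (-1) ^+ r * (c p.-1 ^+ (a - r) * h)@_m.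
  rewrite -!mulrA !mulr_natl mcoeffMn; congr (_ *+ _).
  rewrite -signr_odd -[in RHS]signr_odd.
  by case: (odd r); rewrite ?expr1 ?expr0 ?mulN1r ?mul1r ?mcoeffN.
have -> : c p.-1 = << ucm k0 >> by rewrite /c /k0 (_ : p.-1.-1 = (p - 2)%N) //; lia.
rewrite mcoeff_mulUX -/v; case: leqP => lev; last by rewrite mulr0.
rewrite /h (@mcoeff_hatB N); last 2 first.
- have : (r * p.-1 <= a * p.-1)%N by rewrite leq_mul2r lera orbT.
  by move: leN; lia.
- by move=> i /suppm mi; rewrite lowerE mi.
have k0S : k0.+1 = p.-1 by rewrite /k0; lia.
have wE := wtN_lower ltk0N lev; rewrite k0S in wE.
have -> : (wtN N (lower m k0 (a - r)) == n + r * p.-1)%N = (wtN N m == n + a * p.-1)%N.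
  have -> : (n + a * p.-1 = n + r * p.-1 + (a - r) * p.-1)%N.
    by rewrite -addnA -mulnDl subnKC.
  by rewrite -wE eqn_add2r.
by case: eqP => _; rewrite ?mul1r // mul0r mulr0.
Qed.

Hypothesis wtm : wtN N m = (n + a * p.-1)%N.

Lemma rest_split (F : nat -> nat -> nat) :
  (\sum_(i < N) F i (m i) = F k0 v + \sum_(i < N | (i : nat) != p - 2) F i (m i))%N.
Proof. by rewrite (bigD1 (Ordinal ltk0N)). Qed.

Lemma wtN_rest : wtN N m = (v * p.-1 + rest_wt p N m)%N.
Proof.
rewrite /wtN (rest_split (fun i x => x * i.+1)%N) /k0.
by congr (_ * _ + _)%N; lia.
Qed.

Lemma size_rest : (wtN N m + degN N m = p * v + rest_size p N m)%N.
Proof.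
rewrite wt_degN (rest_split (fun i x => x * i.+2)%N) mulnC.
by congr (_ * _ + _)%N; rewrite /k0; lia.
Qed.

Lemma rest_wt_nmod : rest_wt p N m != 0 %[mod p.-1].
Proof.
apply/eqP => r0; apply: n_nmod; rewrite -[RHS]r0.
by rewrite -[RHS](modnMDl v) -wtN_rest wtm addnC modnMDl.
Qed.

Lemma rest_size_ge2 : (2 <= rest_size p N m)%N.
Proof.
rewrite leqNgt; apply/negP => small; have := rest_wt_nmod.
rewrite /rest_wt big1 ?eqxx // => i ip.
by move: small; rewrite /rest_size (bigD1 i) //=; case: (m i) => // x; lia.
Qed.

Lemma degN_gt0 : (0 < degN N m)%N.
Proof.
rewrite lt0n; apply/negP; rewrite sum_nat_eq0 => /forallP deg0.
suff wt0 : wtN N m = 0%N by move: wtm; rewrite wt0; lia.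
by rewrite /wtN big1 // => i _; have /eqP -> := deg0 i.
Qed.

Lemma rest_gam_gt0 : (0 < rest_gam p N m)%N.
Proof. by apply: prodn_cond_gt0 => i _; rewrite muln_gt0 expn_gt0 fact_gt0. Qed.

Lemma gamN_rest s : (s <= v)%N ->
  gamN N (lower m k0 s) = (p ^ (v - s) * (v - s)`! * rest_gam p N m)%N.
Proof.
move=> les; rewrite /gamN.
rewrite (@lower_split _ _ _ _ ltk0N _ _ muln (fun i x => i.+2 ^ x * x`!)%N).
by congr (_ ^ _ * _ * _)%N; rewrite /k0; lia.
Qed.

Section Quotient.
Variables mu b : nat.
Hypotheses (ltb : (b < p)%N) (sizeE : rest_size p N m = (p * mu + b + 2)%N).

Let q := (v + mu)%N.

Lemma size_divn : (wtN N m + degN N m - 2 = p * q + b)%N.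
Proof. by rewrite size_rest sizeE /q mulnDr !addnA addnK. Qed.

(** Here a < n enters: p q + b = n + a(p-1) + deg - 2 >= a p, while b < p. Hence [q - a] is not
    truncated. *)
Lemma leaq : (a <= q)%N.
Proof.
have sE := size_divn; have deg_gt0 := degN_gt0.
have lt_ap : (a * p < q.+1 * p)%N.
  have apE : (a * p = a * p.-1 + a)%N by rewrite -mulnSr prednK ?prime_gt0.
  rewrite mulSn (mulnC q) apE; rewrite wtm in sE.
  by move: sE deg_gt0 a_lt_n ltb; clear; lia.
by rewrite ltn_mul2r prime_gt0 //= ltnS in lt_ap.
Qed.

(** The sign left once (-1)^s and that of [signed_unit_fact] are taken out. *)
Let eps : int := (-1) ^+ (a + degN N m + 1 + q).

Lemma term_frac s : (s <= a)%N ->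
  (if (s <= v)%N then 'C(a, a - s)%:R * (-1) ^+ (a - s) * tauN N (lower m k0 s)
   else 0) =
  (eps * (p ^ mu * mu`!)%N%:Z * ((-1) ^+ s * 'C(a, s)%:Z *
     ('C(q - s, mu)%:Z * signed_unit_fact p b (q - s))))%:~R
   / (rest_gam p N m)%:R :> rat.
Proof.
move=> lesa; case: leqP => [lesv|ltvs]; last first.
  (* When c_(p-1) occurs to too low a power, q - s < mu and the binomial vanishes too. *)
  by rewrite (@bin_small (q - s)) ?mul0r ?mulr0 ?mul0r // /q; have := leaq; lia.
have dE := degN_lower ltk0N lesv; have wE := wtN_lower ltk0N lesv.
have sE := size_divn.
have lsE : (wtN N (lower m k0 s) + degN N (lower m k0 s) - 2 = p * q + b - s * p)%N.
  have spE : (s * k0.+1 + s = s * p)%N.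
    by rewrite -mulnSr; congr (_ * _)%N; rewrite /k0; move: p_gt2; clear; lia.
  by rewrite -sE -wE -dE -spE addnACA subnAC addnK.
rewrite /tauN lsE (@fact_sub_mul p q b s v mu) // gamN_rest // bin_sub //.
have g0 : (rest_gam p N m)%:R != 0 :> rat.
  by rewrite Num.Theory.pnatr_eq0 -lt0n rest_gam_gt0.
set f := (p ^ (v - s) * (v - s)`!)%N; set P := (p ^ mu * mu`!)%N.
have f0 : f%:R != 0 :> rat.
  by rewrite Num.Theory.pnatr_eq0 -lt0n muln_gt0 expn_gt0 fact_gt0 prime_gt0.
(* Both exponents on the left drop by [s], so their product does not depend on [s]. *)
have sgn : (-1) ^+ (a - s) * (-1) ^+ (degN N (lower m k0 s)).+1 =
   (eps * ((-1) ^+ s * (-1) ^+ (q - s)))%:~R :> rat.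
  rewrite !intrM !rmorphXn /= -!exprD -[LHS]signr_odd -[RHS]signr_odd.
  congr (_ ^+ nat_of_bool _); move: dE (leq_trans lesa leaq).
  move: q (degN N (lower m k0 s)) (degN N m) => x y z <- lesx.
  rewrite !oddD !oddB //=.
  by case: (odd a); case: (odd s); case: (odd x); case: (odd y).
rewrite /signed_unit_fact; set x := ((-1) ^+ s : int); set y := ((-1) ^+ (q - s) : int).
set z := 'C(q - s, mu); set u := unit_fact _ _.
clearbody f P.
have -> : eps * P%:Z * (x * 'C(a, s)%:Z * (z%:Z * (y * u%:Z))) =
    (eps * (x * y)) * (P * 'C(a, s) * z * u)%N%:Z by rewrite !PoszM; ring.
rewrite intrM -sgn -pmulrn !natrM; move: f0 g0.
move: ((-1) ^+ (a - s) : rat) ((-1) ^+ (degN N (lower m k0 s)).+1 : rat) => e1 e2.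
move: (f%:R : rat) (P%:R : rat) (z%:R : rat) (u%:R : rat) => F P' Z W.
move: ((rest_gam p N m)%:R : rat) ('C(a, s)%:R : rat) => G C' F0 G0.
by field; rewrite F0 G0.
Qed.

Lemma mcoeff_sum :
  (\sum_(r < a.+1) 'C(a, r)%:R * (-1) ^+ r * c p.-1 ^+ (a - r)
     * (((n + r * p.-1)%:R : rat)^-1 *: hatB (n + r * p.-1)))@_m =
  (eps * (p ^ mu * mu`!)%N%:Z *
     diff a (fun l => 'C(l, mu)%:Z * signed_unit_fact p b l) (q - a))%:~R
   / (rest_gam p N m)%:R.
Proof.
rewrite raddf_sum /= diff_sum mulr_sumr rmorph_sum mulr_suml /=.
rewrite [LHS](reindex_inj rev_ord_inj) /=; apply: eq_bigr => s _.
have lesa : (s <= a)%N by rewrite -ltnS.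
have -> : (q - a + (a - s) = q - s)%N by rewrite addnBA // subnK // leaq.
by rewrite -(term_frac lesa) subSS mcoeff_term ?leq_subr // subKn // wtm eqxx andbT.
Qed.

End Quotient.

Lemma padic_val_sum : padic_val_ge p (a %/ 2)
  (\sum_(r < a.+1) 'C(a, r)%:R * (-1) ^+ r * c p.-1 ^+ (a - r)
     * (((n + r * p.-1)%:R : rat)^-1 *: hatB (n + r * p.-1)))@_m.
Proof.
set mu := ((rest_size p N m - 2) %/ p)%N; set b := ((rest_size p N m - 2) %% p)%N.
have ltb : (b < p)%N by rewrite ltn_mod prime_gt0.
have sizeE : rest_size p N m = (p * mu + b + 2)%N.
  by rewrite (mulnC p) -divn_eq subnK // rest_size_ge2.
rewrite (mcoeff_sum ltb sizeE); apply: padic_val_ge_frac rest_gam_gt0 _ => //.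
have gam_le := logn_rest_gam_le p_prime p_gt2 rest_wt_nmod; rewrite -/mu in gam_le.
clearbody mu b.
rewrite -mulrA dvdz_mull //.
(* Subtracting the lower half of [mu] leaves its upper half, which together with v(mu!) covers the
   denominator. *)
apply: (@dvdz_trans ((p ^ mu * p ^ logn p mu`!) * p ^ (a./2 - mu./2))%N).
  by rewrite -!expnD dvdzE dvdn_exp2l // divn2; move: gam_le; clear; lia.
rewrite (PoszM (p ^ mu * _)%N); apply: dvdz_mul; last exact: diff_bin_signed_unit_fact.
by rewrite dvdzE dvdn_pmul2l ?expn_gt0 ?prime_gt0 // pfactor_dvdnn.
Qed.

End Coefficient.

Theorem theorem3p1p1 (p a n : nat) (p_prime : prime p) (a_gt0 : (0 < a)%N)
    (n_gt0 : (0 < n)%N) (a_lt_n : (a < n)%N) (n_nmod : n <> 0 %[mod p.-1]) :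
  Qc_congr p (a %/ 2)
    (\sum_(r < a.+1)
       'C(a, r)%:R * (-1) ^+ r * c p.-1 ^+ (a - r)
       * (((n + r * p.-1)%:R : rat)^-1 *: hatB (n + r * p.-1)))
    0.
Proof.
(* For p = 2, every [n] is 0 modulo p - 1. *)
have p_gt2 : (2 < p)%N.
  rewrite ltn_neqAle prime_gt1 // andbT; apply/eqP => p2.
  by apply: n_nmod; rewrite -p2 !modn1.
move=> m; rewrite subr0; have [N0 suppm] := cmonom_bound m.
(* Room for the support of [m], for all weights in the sum and for the index of c_(p-1). *)
pose N := maxn N0 (n + a * p.-1 + p).
have leN : (n + a * p.-1 <= N)%N by rewrite /N; lia.
have ltpN : (p <= N)%N by rewrite /N; lia.
have {}suppm i : (N <= i)%N -> m i = 0%N.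
  by move=> lei; apply: suppm; rewrite /N in lei; lia.
have [wtm|wtm] := eqVneq (wtN N m) (n + a * p.-1)%N.
  exact: padic_val_sum suppm wtm.
rewrite raddf_sum /= big1 => [|r _]; first exact: padic_val_ge0.
have lera : (r <= a)%N by rewrite -ltnS.
apply: etrans (mcoeff_term p_prime p_gt2 a_lt_n a_gt0 n_nmod leN ltpN suppm lera) _.
by rewrite (negbTE wtm) andbF.
Qed.
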